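(* Let $F$ be a known, strictly monotone distribution function on $\mathbb{R}$. Assume that, for every covariate value $x$, $Y\mid x\sim N\{\mu(x,\gamma),\sigma^2(x,\theta)\}$ and $P(R=1\mid x,y)=F\{g(x,\alpha)+\beta y\}$, where $\mu(\cdot,\cdot)$, $\sigma(\cdot,\cdot)>0$ and $g(\cdot,\cdot)$ have known forms, $\gamma,\theta,\alpha$ (possibly vectors) and $\beta\in\mathbb{R}$ are unknown parameters, and the maps $\gamma\mapsto\mu(\cdot,\gamma)$, $\theta\mapsto\sigma(\cdot,\theta)$ and $\alpha\mapsto g(\cdot,\alpha)$ are one-to-one. Then: (a) $\theta$ and $|\beta|$ are identifiable; (b) $\gamma,\theta,\alpha,\beta$ are identifiable if the sign of $\beta$ is known; (c) $\gamma,\theta,\alpha,\beta$ are identifiable if, for every $\delta>0$, $\lim_{z\to-\infty}F(z)/e^{\delta z}$ equals $0$ or $+\infty$; (d) $\gamma,\theta,\alpha,\beta$ are identifiable if the function pair $\{\mu(\cdot,\gamma),\sigma^2(\cdot,\theta)\}$ and the function $g(\cdot,\alpha)$ are linearly uncorrelated, meaning that for every nonzero vector $(a,b,c)\in\mathbb{R}^3$ and all $(\gamma,\theta,\alpha)$, the function $a\,\mu(\cdot,\gamma)+b\,\sigma^2(\cdot,\theta)+g(\cdot,\alpha)$ of $x$ is not identically equal to $c$.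
   Context: $X$ denotes completely observed covariates (with values $x$), $Y$ is an outcome variable and $R\in\{0,1\}$ is its missingness indicator ($R=1$ if $Y$ is observed). The observed distribution is $P(y,R=1\mid x)$ for all $x$, which here is the function $(x,y)\mapsto\frac{1}{\sigma(x,\theta)}\phi\left\{\frac{y-\mu(x,\gamma)}{\sigma(x,\theta)}\right\}F\{g(x,\alpha)+\beta y\}$, where $\phi$ is the standard normal density. A function of the parameters is identifiable if any two parameter vectors in the parameter space that yield the same observed distribution give the same value of that function. ''The sign of $\beta$ is known'' means that the parameter space is restricted to parameter vectors whose $\beta$ has one prescribed sign, so that only parameter vectors with the same sign of $\beta$ are compared. *)

(* Defs.v *)
From HB Require Import structures.
From mathcomp Require Import all_boot all_order all_algebra.
From mathcomp Require Import all_classical all_reals all_analysis.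
Import Order.TTheory GRing.Theory Num.Theory.
Import numFieldNormedType.Exports.

Set Implicit Arguments.
Unset Strict Implicit.
Unset Printing Implicit Defensive.

Local Open Scope classical_set_scope.
Local Open Scope ring_scope.

(* The parameters gamma, theta and alpha range over arbitrary types, so that
   scalars, vectors and subsets of a Euclidean space are all covered. *)
Record param (R : realType) (Gam The Alp : Type) := MkParam {
  gamma : Gam;
  theta : The;
  alpha : Alp;
  beta : R }.

(* Y | x ~ N(mu x gamma, sigma x theta ^ 2) with sigma the standard deviation,
   and P(R = 1 | x, y) = F (g x alpha + beta y); the function below, at (x, y),
   is the density in y of P(y, R = 1 | x). *)
Definition observed (R : realType) (X Gam The Alp : Type) (F : R -> R)
    (mu : X -> Gam -> R) (sigma : X -> The -> R) (g : X -> Alp -> R)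
    (p : param R Gam The Alp) : X -> R -> R :=
  fun x y =>
    1 / sigma x (theta p)
    * normal_pdf 0 1 ((y - mu x (gamma p)) / sigma x (theta p))
    * F (g x (alpha p) + beta p * y).

(* f is a function of the parameters, Omega the parameter space and obs maps a
   parameter to the observed distribution it induces. *)
Definition identifiable (P D T : Type) (Omega : set P) (obs : P -> D)
    (f : P -> T) : Prop :=
  forall p q, Omega p -> Omega q -> obs p = obs q -> f p = f q.

Definition linearly_uncorrelated (R : realType) (X Gam The Alp : Type)
    (Omega : set (param R Gam The Alp))
    (mu : X -> Gam -> R) (sigma : X -> The -> R) (g : X -> Alp -> R) : Prop :=
  forall a b c : R, (a, b, c) != (0, 0, 0) ->
  forall p, Omega p ->
    ~ (forall x, a * mu x (gamma p) + b * sigma x (theta p) ^+ 2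
                 + g x (alpha p) = c).

(* Main.v *)
(* Fix x and write m, s, h for mu, sigma, g.  The ratio of two equal observed
   densities gives F(h + b y) = F(h' + b' y) e^(q y) with q a polynomial of
   degree at most 2, whose quadratic coefficient vanishes iff s = s'; as F is
   bounded and positive, that coefficient is 0.  Then q y = c + d y with
   d = (m' - m) / s^2 and c = - d (m + m') / 2.  If b b' > 0, letting b y tend
   to +oo forces c = d = 0, and F being injective all parameters agree; the
   same limit shows that b and b' vanish together.  If b > 0 > b', letting y
   tend to -oo, and to +oo, gives F(z) ~ e^(k + delta z) at -oo with (k, delta)
   computed first from b and then from b'; as F determines this pair, b' = - b,
   and no such tail is allowed in (c).  Since k and delta do not depend on x,
   eliminating m' yields b m + (delta b^2 / 2) s^2 + h = - k / delta for all x,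
   contradicting (d). *)
Require Import Defs.
From HB Require Import structures.
From mathcomp Require Import all_boot all_order all_algebra.
From mathcomp Require Import all_classical all_reals all_analysis.
From mathcomp Require Import ring lra.
Import Order.TTheory GRing.Theory Num.Theory.
Import numFieldNormedType.Exports.

Local Open Scope classical_set_scope.
Local Open Scope ring_scope.

Section strictly_monotone_cdf.
Set Implicit Arguments.
Unset Strict Implicit.
Context (R : realType).

(** * Limits of exponentials of affine functions *)

Lemma cvg_affine_pinfty (a b : R) :
  0 < b -> a + b * y @[y --> +oo] --> +oo.
Proof.
move=> b0; apply: (@cvg_comp _ _ _ _ (fun z => a + z) _ +oo).
  by apply: gt0_cvgMry => //; exact: cvg_id.
exact: cvg_addrl.
Qed.

(** By continuity of [ln] at 1 the exponent tends to 0; subtracting it from its shift by 1 leaves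
    the constant [d], so [d = 0], and then [c = 0]. *)
Lemma expR_affine_cvg1_pinfty (c d : R) :
  expR (c + d * y) @[y --> +oo] --> (1 : R) -> c = 0 /\ d = 0.
Proof.
move=> cvg1.
have cvg0 : c + d * y @[y --> +oo] --> (0 : R).
  rewrite -(@ln1 R).
  have -> : (fun y => c + d * y) = ln (R:=R) \o (fun y => expR (c + d * y)).
    by apply/funext => y /=; rewrite expRK.
  exact: (cvg_comp _ _ cvg1 (continuous_ln ltr01)).
have cvg0S : c + d * (1 + y) @[y --> +oo] --> (0 : R).
  exact: (cvg_comp _ _ (cvg_addrl 1) cvg0).
have d0 : d = 0.
  have : (c + d * (1 + y)) - (c + d * y) @[y --> +oo] --> (0 - 0 : R).
    exact: cvgB.
  have -> : (fun y => c + d * (1 + y) - (c + d * y)) = cst d.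
    by apply/funext => y /=; ring.
  by rewrite subr0 => /(cvg_unique (@Rhausdorff R) (cvg_cst d)).
split=> //; move: cvg0; have -> : (fun y => c + d * y) = cst c.
  by apply/funext => y /=; rewrite d0 mul0r addr0.
by move=> /(cvg_unique (@Rhausdorff R) (cvg_cst c)).
Qed.

Lemma expR_affine_cvg1_ninfty (c d : R) :
  expR (c + d * y) @[y --> -oo] --> (1 : R) -> c = 0 /\ d = 0.
Proof.
move/cvgNy_compNP => /= cvg1.
have [-> /eqP] : c = 0 /\ - d = 0.
  apply: expR_affine_cvg1_pinfty.
  have -> // : (fun y => expR (c + - d * y)) = (fun y => expR (c + d * - y)).
  by apply/funext => y; rewrite mulNr mulrN.
by rewrite oppr_eq0 => /eqP ->.
Qed.

Lemma quadratic_unbounded (a b c M : R) :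
  0 < a -> exists2 y, 0 <= y & M < a * y ^+ 2 + b * y + c.
Proof.
(* This [y] is at least 1 and makes [a * y + b] at least [a + |c| + |M|]; a further factor [y] only
   increases the bound. *)
move=> a0; pose y := 1 + (`|b| + `|c| + `|M|) / a.
have y1 : 1 <= y by rewrite lerDl divr_ge0 ?addr_ge0 // ltW.
have ay : a * y = a + `|b| + `|c| + `|M|.
  by rewrite /y mulrDr mulr1 mulrCA divff ?gt_eqF // mulr1 !addrA.
exists y; first by lra.
have -> : a * y ^+ 2 + b * y = (a * y + b) * y by ring.
have cM : a + `|c| + `|M| <= a * y + b.
  by rewrite ay; have := ler_norm (- b); rewrite normrN; lra.
have cM0 : 0 <= a + `|c| + `|M| by rewrite !addr_ge0 // ltW.
have le1 : a + `|c| + `|M| <= (a * y + b) * y.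
  by rewrite (le_trans cM) // ler_peMr // (le_trans cM0).
have := ler_norm M; have := ler_norm (- c); rewrite normrN; lra.
Qed.

Definition exp_linked (F : R -> R) (h b h' b' c d : R) :=
  forall y, F (h + b * y) = F (h' + b' * y) * expR (c + d * y).

Definition exp_tail (F : R -> R) (k delta : R) :=
  F z / expR (k + delta * z) @[z --> -oo] --> (1 : R).

(** * Strictly increasing distribution functions *)

Context (F : cumulativeBounded (0 : R) (1 : R)).
Context (F_mono : {homo F : z w / z < w}).

Lemma cdf_le : {homo F : z w / z <= w}.
Proof. exact: ltW_homo. Qed.

Lemma cdf_inj : injective F.
Proof. exact/inc_inj/le_mono. Qed.

Lemma cdf_gt0 z : 0 < F z.
Proof.
apply: (@le_lt_trans _ _ (F (z - 1))); last by apply: F_mono; lra.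
rewrite -[leLHS](cvg_lim (@Rhausdorff R) (cumulativeNy F)).
apply: limr_le; first by apply/cvg_ex; exists 0; exact: cumulativeNy.
by near=> w; apply: cdf_le; near: w; exact: nbhs_ninfty_le.
Unshelve. all: by end_near. Qed.

Lemma cdf_le1 z : F z <= 1.
Proof.
rewrite -[leRHS](cvg_lim (@Rhausdorff R) (cumulativey F)).
apply: limr_ge; first by apply/cvg_ex; exists 1; exact: cumulativey.
by near=> w; apply: cdf_le; near: w; exact: nbhs_pinfty_ge.
Unshelve. all: by end_near. Qed.

Lemma cdf_affine_cvg1 (h b : R) :
  0 < b -> F (h + b * y) @[y --> +oo] --> (1 : R).
Proof.
by move=> b0; exact: cvg_comp (cvg_affine_pinfty h b0) (cumulativey F).
Qed.

(** * Exponential links and the signs of the two slopes *)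

Lemma exp_linked_sym (h b h' b' c d : R) :
  exp_linked F h b h' b' c d -> exp_linked F h' b' h b (- c) (- d).
Proof.
move=> link y; rewrite link -mulrA -expRD.
rewrite (_ : c + d * y + _ = 0) ?expR0 ?mulr1 //; ring.
Qed.

(** Reflecting [y] flips the sign of both slopes, so negative slopes reduce to positive ones. *)
Lemma exp_linked_opp (h b h' b' c d : R) :
  exp_linked F h b h' b' c d -> exp_linked F h (- b) h' (- b') c (- d).
Proof. by move=> link y; have := link (- y); rewrite !mulNr !mulrN. Qed.

Lemma exp_linked_quadratic_false (h b h' b' A B C : R) : 0 < A ->
  ~ (forall y, F (h + b * y) =
               F (h' + b' * y) * expR (A * y ^+ 2 + B * y + C)).
Proof.
move=> A0 eqF.
(* At such a [y] the factor [F (h' + b' * y)] is at least [F h'], while the exponential exceeds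
   [1 / F h'] because [expR q >= 1 + q]; the product then exceeds 1, which [F] cannot. *)
have [y b'y q] : exists2 y,
    0 <= b' * y & (F h')^-1 < A * y ^+ 2 + B * y + C.
  have [b'0|b'0] := leP 0 b'.
    have [y y0 ?] := quadratic_unbounded B C (F h')^-1 A0.
    by exists y => //; exact: mulr_ge0.
  have [y y0 ?] := quadratic_unbounded (- B) C (F h')^-1 A0.
  exists (- y); first by rewrite mulr_le0 ?oppr_le0 // ltW.
  by rewrite sqrrN mulrN -mulNr.
have := cdf_le1 (h + b * y); rewrite eqF leNgt => /negP; apply.
have F0 := cdf_gt0 h'.
apply: (@lt_le_trans _ _ (F h' * expR (A * y ^+ 2 + B * y + C))).
  rewrite -ltr_pdivrMl // mulr1 (lt_le_trans q) //.
  by apply: le_trans (expR_ge1Dx _); lra.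
by rewrite ler_pM2r ?expR_gt0 //; apply: cdf_le; lra.
Qed.

(** Since [F (h' + b' * y)] tends to 1, the exponential alone tends to [L]. It is used with [L = 1]
    for [b > 0] and with [L = F h] for [b = 0]. *)
Lemma exp_linked_exponent (h b h' b' c d L : R) : 0 < L -> 0 < b' ->
  F (h + b * y) @[y --> +oo] --> L ->
  exp_linked F h b h' b' c d -> c = ln L /\ d = 0.
Proof.
move=> L0 b'0 FL link.
have [|/eqP + ->] := @expR_affine_cvg1_pinfty (c - ln L) d.
  have -> : 1 = L / 1 / L by rewrite divr1 divff // gt_eqF.
  have eqE : (fun y => expR (c - ln L + d * y)) =
             (fun y => F (h + b * y) / F (h' + b' * y) / L).
    apply/funext => y; rewrite link [_ / F _]mulrAC.
    rewrite divff ?gt_eqF ?cdf_gt0 // mul1r.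
    rewrite -{2}(lnK L0) -expRN -expRD; congr expR; ring.
  rewrite eqE; apply: cvgM; last exact: cvg_cst.
  apply: cvgM => //; apply: cvgV; first exact: oner_neq0.
  exact: cdf_affine_cvg1.
by rewrite subr_eq0 => /eqP.
Qed.

Lemma exp_linked_pos_eq (h b h' b' c d : R) : 0 < b -> 0 < b' ->
  exp_linked F h b h' b' c d -> d = 0 /\ (b = b' /\ h = h').
Proof.
move=> b0 b'0 link.
have [c0 d0] := exp_linked_exponent ltr01 b'0
  (cdf_affine_cvg1 h b0) link.
split=> //; rewrite ln1 in c0; subst c d.
have eq0 := link 0; have eq1 := link 1.
rewrite ?(mul0r, mulr0, addr0, expR0, mulr1) in eq0 eq1.
by move/cdf_inj in eq0; move/cdf_inj in eq1; split; lra.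
Qed.

Lemma exp_linked_zero_pos (h b' h' c d : R) : 0 < b' ->
  ~ exp_linked F h 0 h' b' c d.
Proof.
move=> b'0 link.
have Fh : F (h + 0 * y) @[y --> +oo] --> F h.
  have -> : (fun y => F (h + 0 * y)) = cst (F h).
    by apply/funext => y /=; rewrite mul0r addr0.
  exact: cvg_cst.
have [c0 d0] := exp_linked_exponent (cdf_gt0 h) b'0 Fh link.
have := link 1; have := link 0; rewrite d0 !mul0r => -> /mulIf.
by rewrite gt_eqF ?expR_gt0 // => /(_ isT) /cdf_inj; lra.
Qed.

Lemma exp_linked_zero (h b' h' c d : R) :
  exp_linked F h 0 h' b' c d -> b' = 0.
Proof.
move=> link; have [b'0|b'0|//] := ltgtP b' 0; exfalso.
  have := exp_linked_opp link; rewrite oppr0.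
  by apply: exp_linked_zero_pos; rewrite oppr_gt0.
exact: exp_linked_zero_pos link.
Qed.

(** If both slopes vanish, the link is constant in [y] and leaves [c] free, hence the proviso
    [c = 0]. For observed distributions [c] is a multiple of [d], so [d = 0] supplies it. *)
Lemma exp_linked_same_sign (h b h' b' c d : R) : Num.sg b = Num.sg b' ->
  exp_linked F h b h' b' c d ->
  d = 0 /\ (c = 0 -> b = b' /\ h = h').
Proof.
have [-> sg0 link|b0 sg1 link|b0 sgN1 link] := sgrP b.
- have b'0 := exp_linked_zero link; rewrite b'0 in link *.
  have [eq0 eq1] := (link 0, link 1).
  have d0 : d = 0.
    move: eq1; rewrite !mul0r !addr0 in eq0 *; rewrite eq0 mulr0 mulr1 addr0.
    move=> /mulfI; rewrite gt_eqF ?cdf_gt0 // => /(_ isT) /expR_inj; lra.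
  split=> // c0; split=> //; apply: cdf_inj; move: eq0.
  by rewrite c0 d0 !mul0r !addr0 expR0 mulr1.
- have b'0 : 0 < b' by rewrite -sgr_cp0 -sg1.
  by have [-> ?] := exp_linked_pos_eq b0 b'0 link.
- have b'0 : b' < 0 by rewrite -sgr_cp0 -sgN1.
  have [] := exp_linked_pos_eq _ _ (exp_linked_opp link); rewrite ?oppr_gt0 //.
  by move=> /eqP; rewrite oppr_eq0 => /eqP -> [/oppr_inj].
Qed.

(** * Exponential tails at minus infinity *)

Lemma exp_tail_unique (k delta k' delta' : R) :
  exp_tail F k delta -> exp_tail F k' delta' -> k = k' /\ delta = delta'.
Proof.
move=> tail tail'.
have [] := @expR_affine_cvg1_ninfty (k' - k) (delta' - delta).
  rewrite -[1](divr1 1).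
  have eqE : (fun z => expR (k' - k + (delta' - delta) * z)) =
             (fun z => (F z / expR (k + delta * z))
                       / (F z / expR (k' + delta' * z))).
    apply/funext => z; have := cdf_gt0 z; have := expR_gt0 (k + delta * z).
    have -> : k' - k + (delta' - delta) * z
              = (k' + delta' * z) - (k + delta * z) by ring.
    rewrite expRB; have := expR_gt0 (k' + delta' * z) => *.
    by field; rewrite !gt_eqF.
  by rewrite eqE; apply: cvgM => //; apply: cvgV; rewrite ?oner_neq0.
by move=> *; split; lra.
Qed.

(** For [delta <= 0] and [z <= 0] the quotient is at most [F z / expR k], which tends to 0 and not
    to 1. *)
Lemma exp_tail_gt0 (k delta : R) : exp_tail F k delta -> 0 < delta.
Proof.
move=> tail; rewrite ltNge; apply/negP => delta0.
suff : F z / expR (k + delta * z) @[z --> -oo] --> (0 : R).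
  move/(cvg_unique (@Rhausdorff R) tail) => /eqP.
  by rewrite oner_eq0.
apply: (@squeeze_cvgr _ _ _ _ (fun=> 0) (fun z => F z / expR k)).
- near=> z; rewrite divr_ge0 ?expR_ge0 ?(ltW (cdf_gt0 _)) //=.
  rewrite ler_pM2l ?cdf_gt0 // lef_pV2 ?posrE ?expR_gt0 // ler_expR lerDl.
  by rewrite mulr_le0 //; near: z; exact: nbhs_ninfty_le.
- exact: cvg_cst.
- rewrite -[X in _ --> X](mul0r (expR k)^-1).
  by apply: cvgM; [exact: cumulativeNy | exact: cvg_cst].
Unshelve. all: by end_near. Qed.

Lemma exp_tail_cvg (k delta : R) : exp_tail F k delta ->
  F z / expR (delta * z) @[z --> -oo] --> expR k.
Proof.
move=> tail; rewrite -[expR k]mulr1.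
have -> : (fun z => F z / expR (delta * z))
          = (fun z => expR k * (F z / expR (k + delta * z))).
  apply/funext => z; rewrite expRD.
  by field; rewrite !gt_eqF ?expR_gt0.
by apply: cvgM => //; exact: cvg_cst.
Qed.

Lemma exp_linked_tail (h b h' b' c d : R) : 0 < b -> b' < 0 ->
  exp_linked F h b h' b' c d ->
  exp_tail F (c - d * h / b) (d / b).
Proof.
move=> b0 b'0 link.
have eqE : (fun z => F z / expR (c - d * h / b + d / b * z))
           = (fun z => F ((h' - b' * h / b) + (b' / b) * z)).
  (* The substitution [z = h + b * y] isolates [F z]; the other argument has slope [b' / b < 0] in
     [z], so its [F] tends to 1 at minus infinity. *)
  apply/funext => z; have := link ((z - h) / b).
  have -> : h + b * ((z - h) / b) = z by field; rewrite gt_eqF.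
  have -> : h' + b' * ((z - h) / b) = (h' - b' * h / b) + (b' / b) * z.
    by field; rewrite gt_eqF.
  have -> : c + d * ((z - h) / b) = c - d * h / b + d / b * z.
    by field; rewrite gt_eqF.
  by move->; rewrite mulfK // gt_eqF ?expR_gt0.
rewrite /exp_tail eqE; apply/cvgNy_compNP => /=.
have : 0 < - (b' / b) by rewrite -mulNr divr_gt0 ?oppr_gt0.
move/(cdf_affine_cvg1 (h' - b' * h / b)).
have -> // : (fun z => F (h' - b' * h / b + - (b' / b) * z))
             = (fun z => F (h' - b' * h / b + b' / b * - z)).
by apply/funext => z; rewrite mulNr mulrN.
Qed.

Lemma exp_linked_opposite_sign (h b h' b' c d : R) : 0 < b -> b' < 0 ->
  exp_linked F h b h' b' c d ->
  [/\ b' = - b, 0 < d & exp_tail F (c - d * h / b) (d / b)].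
Proof.
move=> b0 b'0 link.
have tail := exp_linked_tail b0 b'0 link.
have d0 : 0 < d by have := exp_tail_gt0 tail; rewrite pmulr_lgt0 ?invr_gt0.
(* Exchanging the two sides and reflecting [y] makes [- b'] the positive slope; uniqueness of the
   tail then gives [d / b = d / (- b')]. *)
have tail' : exp_tail F (- c - d * h' / (- b')) (d / (- b')).
  have := exp_linked_opp (exp_linked_sym link).
  by rewrite opprK; apply: exp_linked_tail; rewrite ?oppr_gt0 ?oppr_lt0.
have [_ /(mulfI (lt0r_neq0 d0)) /invr_inj bE] := exp_tail_unique tail tail'.
by split; rewrite // bE opprK.
Qed.

(** * From equal observed distributions to a link at each covariate value *)

Lemma observed_eq_linked (X Gam The Alp : Type)
    (mu : X -> Gam -> R) (sigma : X -> The -> R) (g : X -> Alp -> R)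
    (sigma_gt0 : forall x t, 0 < sigma x t) (p q : param R Gam The Alp) x :
  observed F mu sigma g p = observed F mu sigma g q ->
  sigma x (theta p) = sigma x (theta q) /\
  let d := (mu x (gamma q) - mu x (gamma p)) / sigma x (theta p) ^+ 2 in
  exp_linked F (g x (alpha p)) (beta p) (g x (alpha q)) (beta q)
    (- d * (mu x (gamma p) + mu x (gamma q)) / 2) d.
Proof.
move=> /(congr1 (fun f => f x)).
rewrite /observed; move: (sigma_gt0 x (theta p)) (sigma_gt0 x (theta q)).
move: (sigma x (theta p)) (sigma x (theta q)) => s s' s0 s'0.
move: (mu x (gamma p)) (mu x (gamma q)) => m m'.
move: (g x (alpha p)) (g x (alpha q)) (beta p) (beta q) => h h' b b'.
rewrite normal_pdfE ?oner_neq0 // => obsE.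
have eqF y : F (h + b * y) = F (h' + b' * y) * expR (
    (ln s - ln s') + (((y - m) / s) ^+ 2 - ((y - m') / s') ^+ 2) / 2).
  have := congr1 (fun f => f y) obsE; rewrite /normal_fun !subr0 expr1n.
  have -> : (ln s - ln s') + (((y - m) / s) ^+ 2 - ((y - m') / s') ^+ 2) / 2
    = ln s - ln s'
      + (- (((y - m') / s') ^+ 2 / 2) - (- (((y - m) / s) ^+ 2 / 2))).
    by ring.
  rewrite !mulNr expRD expRB lnK ?posrE // expRB lnK ?posrE //.
  have : 0 < normal_peak (1 : R) by rewrite normal_peak_gt0 ?oner_neq0.
  move: (expR_gt0 (- (((y - m) / s) ^+ 2 / 2))).
  move: (normal_peak 1) (expR (- (((y - m) / s) ^+ 2 / 2))) => P E E0 P0 obsEy.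
  have -> : F (h + b * y) = s / (P * E) * (1 / s * (P * E) * F (h + b * y)).
    by field; rewrite !gt_eqF.
  by rewrite obsEy; field; rewrite !gt_eqF.
(* Coefficients of the log-ratio of the two normal densities; [A] has the sign of [s' - s]. *)
pose A : R := (s ^- 2 - s' ^- 2) / 2.
pose B : R := m' / s' ^+ 2 - m / s ^+ 2.
pose C : R := ln s - ln s' + ((m / s) ^+ 2 - (m' / s') ^+ 2) / 2.
have qE y : (ln s - ln s') + (((y - m) / s) ^+ 2 - ((y - m') / s') ^+ 2) / 2
            = A * y ^+ 2 + B * y + C.
  by rewrite /A /B /C; field; rewrite !gt_eqF.
have {qE}eqF y : F (h + b * y) =
    F (h' + b' * y) * expR (A * y ^+ 2 + B * y + C) by rewrite eqF qE.
have eqs : s = s'.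
  have [lts|lts|//] := ltgtP s s'; exfalso.
    apply: (exp_linked_quadratic_false _ eqF).
    by rewrite divr_gt0 // subr_gt0 ltf_pV2 ?posrE ?exprn_gt0 // ltrXn2r // ltW.
  (* Here [s' < s]: exchanging the two sides negates the exponent and restores a positive leading
     coefficient. *)
  have A0 : 0 < - A.
    rewrite oppr_gt0 /A pmulr_llt0 ?invr_gt0 // subr_lt0.
    by rewrite ltf_pV2 ?posrE ?exprn_gt0 // ltrXn2r // ltW.
  apply: (@exp_linked_quadratic_false h' b' h b (- A) (- B) (- C) A0) => y.
  rewrite eqF -mulrA -expRD.
  by rewrite (_ : A * _ + _ + _ + _ = 0) ?expR0 ?mulr1 //; ring.
split=> // y; rewrite eqF; congr (_ * expR _).
by rewrite /A /B /C -eqs; field; rewrite gt_eqF.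
Qed.

End strictly_monotone_cdf.

(** * Identifiability by comparing the signs of the slopes *)

Theorem theorem2 (R : realType) (X Gam The Alp : Type)
    (F : cumulativeBounded (0 : R) (1 : R))
    (mu : X -> Gam -> R) (sigma : X -> The -> R) (g : X -> Alp -> R)
    (Omega : set (param R Gam The Alp))
    (X_nonempty : [set: X] !=set0)
    (F_mono : {homo F : z w / z < w})
    (sigma_gt0 : forall x t, 0 < sigma x t)
    (mu_inj : injective (fun (c : Gam) (x : X) => mu x c))
    (sigma_inj : injective (fun (t : The) (x : X) => sigma x t))
    (g_inj : injective (fun (a : Alp) (x : X) => g x a)) :
  let obs := observed F mu sigma g in
  let params (p : param R Gam The Alp) :=
    (gamma p, theta p, alpha p, beta p) in
  [/\ (* (a) *)
      identifiable Omega obs (fun p => theta p) /\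
      identifiable Omega obs (fun p => `|beta p|),
      (* (b) *)
      (forall s : R,
        identifiable (Omega `&` [set p | Num.sg (beta p) = s]) obs params),
      (* (c) *)
      ((forall delta : R, 0 < delta ->
          (F z / expR (delta * z) @[z --> -oo] --> 0) \/
          (F z / expR (delta * z) @[z --> -oo] --> +oo)) ->
        identifiable Omega obs params)
    & (* (d) *)
      (linearly_uncorrelated Omega mu sigma g ->
        identifiable Omega obs params)].
Proof.
move=> obs params; have [x0 _] := X_nonempty.
have linkP p q (pq : obs p = obs q) x :=
  observed_eq_linked F_mono sigma_gt0 x pq.
have eq_theta p q : obs p = obs q -> theta p = theta q.
  by move=> pq; apply/sigma_inj/funext => x; have [] := linkP _ _ pq x.
have eq_params p q : obs p = obs q -> Num.sg (beta p) = Num.sg (beta q) ->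
    params p = params q.
  move=> pq sgE.
  have {}linkP x : [/\ mu x (gamma p) = mu x (gamma q), beta p = beta q
                     & g x (alpha p) = g x (alpha q)].
    have [_ /(exp_linked_same_sign F_mono sgE)[d0]] := linkP _ _ pq x.
    rewrite d0 oppr0 !mul0r => /(_ erefl)[-> ->]; split=> //; apply/eqP.
    move/eqP: d0; rewrite mulf_eq0 invr_eq0 expf_eq0 /=.
    by rewrite (gt_eqF (sigma_gt0 _ _)) orbF subr_eq0 eq_sym.
  congr (_, _, _, _); [|exact: eq_theta| |by have [] := linkP x0].
    by apply/mu_inj/funext => x; have [] := linkP x.
  by apply/g_inj/funext => x; have [] := linkP x.
have opposite p q : obs p = obs q -> 0 < beta p -> beta q < 0 ->
    beta q = - beta p /\
    exists k delta : R, [/\ 0 < delta, exp_tail F k delta & forall x,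
      beta p * mu x (gamma p)
      + delta * beta p ^+ 2 / 2 * sigma x (theta p) ^+ 2
      + g x (alpha p) = - k / delta].
  move=> pq p0 q0.
  have opp x := exp_linked_opposite_sign F_mono p0 q0 (linkP _ _ pq x).2.
  have [-> d0 tail0] := opp x0; split=> //.
  eexists _, _; split; [|exact: tail0|]; first exact: divr_gt0.
  move=> x; have [_ d1 tail1] := opp x.
  (* The tail found at [x0] is also the one found at [x]. With [m], [m'] the two means and [b], [h]
     the slope and intercept of [p] at [x], both sides equal [b * (m + m') / 2 + h]. *)
  have [-> ->] := exp_tail_unique F_mono tail0 tail1; move: d1 {tail1}.
  have s0 := sigma_gt0 x (theta p).
  rewrite pmulr_lgt0 ?invr_gt0 ?exprn_gt0 // => m0.
  by field; rewrite !gt_eqF.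
have sign_cases p q : obs p = obs q ->
    [\/ params p = params q, 0 < beta p /\ beta q < 0
      | 0 < beta q /\ beta p < 0].
  move=> pq; have [_ link] := linkP _ _ pq x0.
  have [p0|p0|p0] := ltgtP (beta p) 0; have [q0|q0|q0] := ltgtP (beta q) 0.
  - by apply: Or31; apply: eq_params; rewrite ?ltr0_sg.
  - exact: Or33.
  - move: (exp_linked_sym link); rewrite q0 => /(exp_linked_zero F_mono).
    by lra.
  - exact: Or32.
  - by apply: Or31; apply: eq_params; rewrite ?gtr0_sg.
  - move: (exp_linked_sym link); rewrite q0 => /(exp_linked_zero F_mono).
    by lra.
  - by move: link; rewrite p0 => /(exp_linked_zero F_mono); lra.
  - by move: link; rewrite p0 => /(exp_linked_zero F_mono); lra.
  - by apply: Or31; apply: eq_params; rewrite ?p0 ?q0.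
split.
- split=> p q _ _ pq; first exact: eq_theta.
  have [[_ _ _ -> //]|[p0 q0]|[q0 p0]] := sign_cases p q pq.
    by have [-> _] := opposite p q pq p0 q0; rewrite normrN.
  by have [-> _] := opposite q p (esym pq) q0 p0; rewrite normrN.
- by move=> s p q [_ /= ps] [_ /= qs] pq; apply: eq_params; rewrite ?ps.
- move=> hF p q _ _ pq.
  (* A tail would make [F z / expR (delta * z)] tend to [expR k], which is neither 0 nor
     infinite. *)
  have noTail (k delta : R) : 0 < delta -> ~ exp_tail F k delta.
    move=> delta0 /exp_tail_cvg Fk; have [F0|Fy] := hF delta delta0.
      move: F0 => /(cvg_unique (@Rhausdorff R) Fk) /eqP.
      by rewrite gt_eqF ?expR_gt0.
    have := cvgr_lt _ Fk (expR k + 1); rewrite ltrDl => /(_ _ ltr01) Flt.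
    have /cvgryPge/(_ (expR k + 1)) Fge := Fy.
    have [z /= []] := filter_ex (filterI Flt Fge).
    by move=> /lt_le_trans /[apply]; rewrite ltxx.
  have [//|[p0 q0]|[q0 p0]] := sign_cases p q pq; exfalso.
    by have [_ [k [delta [/noTail nt /nt]]]] := opposite p q pq p0 q0.
  by have [_ [k [delta [/noTail nt /nt]]]] := opposite q p (esym pq) q0 p0.
- move=> unc p q Op Oq pq.
  (* The parameter with positive slope satisfies the forbidden linear relation; that slope is the
     coefficient of [mu], so the coefficient vector is nonzero. *)
  have contra r b delta k : 0 < b -> Omega r ->
    ~ (forall x, b * mu x (gamma r) + delta * sigma x (theta r) ^+ 2
                 + g x (alpha r) = k).
    by move=> b0; apply: unc; rewrite !xpair_eqE gt_eqF.
  have [//|[p0 q0]|[q0 p0]] := sign_cases p q pq; exfalso.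
    have [_ [k [delta [_ _]]]] := opposite p q pq p0 q0; exact: contra.
  have [_ [k [delta [_ _]]]] := opposite q p (esym pq) q0 p0; exact: contra.
Qed.
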